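(* Let $b\ge 2$ be an integer with prime factorization $b=p_1^{a_1}p_2^{a_2}\cdots p_r^{a_r}$ (distinct primes $p_i$, exponents $a_i\ge 1$), where the prime factors are indexed so that $a_1(p_1-1)\ge a_2(p_2-1)\ge \dots \ge a_r(p_r-1)$. Then the sequence $\left(\ell_b(n!)\right)_{n\in\mathbb{N}}$ is $p_1$-automatic if $a_1(p_1-1)>a_2(p_2-1)$ or $b=p_1^{a_1}$ (i.e. $r=1$), and it is not $k$-automatic for any integer $k\ge 2$ otherwise (i.e. when $r\ge 2$ and $a_1(p_1-1)=a_2(p_2-1)$).
   Context: For an integer $b\ge 2$ and a positive integer $m$, $\ell_b(m)$ denotes the last nonzero digit of $m$ in base $b$, i.e. $\ell_b(m)\in\{1,\dots,b-1\}$ with $\ell_b(m)\equiv m/b^{v_b(m)} \pmod b$, where $v_b(m)$ is the largest integer $t$ with $b^t\mid m$. A deterministic finite automaton with output (DFAO) is a tuple $(Q,\Sigma,\rho,q_0,\Delta,\tau)$ with $Q$ a finite set of states, $\Sigma$ a finite input alphabet, $\rho:Q\times\Sigma\to Q$ a transition function (extended to words by $\rho(q,s_1s_2\cdots s_m)=\rho(\cdots\rho(\rho(q,s_1),s_2)\cdots,s_m)$), $q_0\in Q$ an initial state, $\Delta$ a finite output alphabet and $\tau:Q\to\Delta$ an output function. For an integer $k\ge2$, a sequence $(a(n))_{n\in\mathbb{N}}$ is $k$-automatic if there is a DFAO with input alphabet $\{0,1,\dots,k-1\}$ such that $a(n)=\tau(\rho(q_0,[n]_k))$ for all $n$, where $[n]_k$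 is the string of base-$k$ digits of $n$ (whether the string is read from the most or least significant digit does not affect this notion). *)

(* Defs.v *)
From mathcomp Require Import all_boot.

Set Implicit Arguments.
Unset Strict Implicit.
Unset Printing Implicit Defensive.

(* The largest t with b ^ t %| m. When 1 < b and 0 < m, every such t satisfies
   t < b ^ t <= m, so bounding t by m loses nothing (see base_valP). *)
Definition base_val (b m : nat) : nat := \max_(t < m.+1 | b ^ t %| m) t.

Definition last_nonzero_digit (b m : nat) : nat := (m %/ b ^ base_val b m) %% b.

(* The output alphabet is a finite list of values of T. *)
Record dfao (Sigma : finType) (T : eqType) : Type := DFAO {
  dfao_state : finType;
  dfao_trans : dfao_state -> Sigma -> dfao_state;
  dfao_start : dfao_state;
  dfao_outalph : seq T;
  dfao_out : dfao_state -> T;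
  dfao_outP : forall q, dfao_out q \in dfao_outalph
}.

Definition dfao_run (Sigma : finType) (T : eqType) (M : dfao Sigma T)
    (w : seq Sigma) : T :=
  dfao_out (foldl (@dfao_trans _ _ M) (dfao_start M) w).

Fixpoint digits_rec (k fuel n : nat) : seq nat :=
  if fuel is f.+1 then
    if n == 0 then [::] else rcons (digits_rec k f (n %/ k)) (n %% k)
  else [::].

(* Base-k digits of n, most significant first, without leading zeros; 0 is
   represented by the empty word. Fuel n is enough as soon as 1 < k. *)
Definition digits (k n : nat) : seq nat := digits_rec k n n.

(* The same digits, seen in the alphabet {0, ..., k - 1}; nothing is dropped
   by pmap insub when 1 < k (see digit_wordE). *)
Definition digit_word (k n : nat) : seq 'I_k := pmap insub (digits k n).

Definition automatic (T : eqType) (k : nat) (a : nat -> T) : Prop :=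
  exists M : dfao 'I_k T, forall n, a n = dfao_run M (digit_word k n).

Lemma base_valP b m t : 1 < b -> 0 < m -> (b ^ t %| m) = (t <= base_val b m).
Proof.
move=> b1 m0; have lt_m s : b ^ s %| m -> s < m.+1.
  by move=> /(dvdn_leq m0) sm; apply: leq_trans (ltn_expl s b1) (leqW sm).
apply/idP/idP => [tm|tv].
  exact: (@leq_bigmax_cond _ (fun s : 'I_m.+1 => b ^ s %| m) (fun s => s : nat)
            (Ordinal (lt_m _ tm)) tm).
have [s sm vs] : {s : 'I_m.+1 | b ^ s %| m & base_val b m = s}.
  apply: (@eq_bigmax_cond _ (fun s : 'I_m.+1 => b ^ s %| m) (fun s => s : nat)).
  by apply/card_gt0P; exists ord0; rewrite unfold_in /= expn0 dvd1n.
by apply: dvdn_trans sm; apply: dvdn_exp2l; rewrite -vs.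
Qed.

Lemma digit_wordE k n : 1 < k -> [seq val d | d <- digit_word k n] = digits k n.
Proof.
move=> k1; rewrite /digit_word (pmap_filter (@insubK _ _ _)).
rewrite (@eq_filter _ _ (fun d => d < k)) => [|d]; last by rewrite isSome_insub.
apply/all_filterP; rewrite /digits; move: {1}n => f.
elim: f n => //= f IHf n.
by case: eqP => // _; rewrite all_rcons ltn_mod (ltnW k1) IHf.
Qed.

Lemma digitsK k n : 1 < k -> foldl (fun m d => m * k + d) 0 (digits k n) = n.
Proof.
move=> k1; rewrite /digits; have := leqnn n; move: {2 3}n => f.
elim: f n => [|f IHf] n /=; first by rewrite leqn0 => /eqP ->.
case: (posnP n) => // n0 nf; rewrite foldl_rcons IHf -?divn_eq //.
by rewrite -ltnS (leq_trans (ltn_Pdiv k1 n0)).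
Qed.

(* Main.v *)
(** Write [S p n] for the base-[p] digit sum. By Legendre's formula
    [(p - 1) * v_p(n!) = n - S p n], so with [c_i = a_i (p_i - 1)] the
    base-[b] valuation of [n!] is the largest [e] with [c_i e + S p_i n <= n]
    for all [i], and [p_i ^ a_i] divides the last nonzero digit iff the
    inequality of index [i] still holds for [e + 1].

    If [c_1] is strictly maximal then, digit sums being logarithmic, index 1
    alone decides for large [n]: the last digit is divisible by the other prime
    powers, and modulo [p_1 ^ a_1] it depends on [v_p(n!)] and on the part of
    [n!] prime to [p = p_1], whose residues obey a finite recursion in the
    base-[p] digits: [(n p + d)!] is [p ^ n * n!] times the product of the
    [j <= n p + d] prime to [p], which modulo [p ^ a_1] is periodic in [n].

    If several indices are tied, let [P] be the largest tied prime and [Q]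
    another one, and let [W] be the set of [n] whose last digit is not divisible
    by the power of [P] in [b]. For every [t] some block
    [[n k^t, (n + 1) k^t)] misses [W]: numbers slightly above a power [P ^ N]
    congruent to [1 - Q ^ M] modulo [Q ^ (2 M)] have a bounded base-[P] digit
    sum and a large base-[Q] one. On the other hand, for fixed [n], the block
    meets [W] as soon as [t] is large: it contains some [H P ^ K - 1] with [H]
    bounded, and this number has a larger digit sum in base [P] than in any
    smaller base [q], since [q ^ (P - 1) > P ^ (q - 1)]. In a [k]-automatic
    sequence the block of [n] depends only on [t] and on one of finitely many
    states, so the two facts are incompatible. *)

Require Import Defs.
From mathcomp Require Import all_boot cyclic.
From mathcomp Require Import zify.
From Stdlib Require Import Classical_Prop.

Set Implicit Arguments.
Unset Strict Implicit.
Unset Printing Implicit Defensive.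

(** * Digits and digit sums *)

Lemma digits_rec_fuel k f g n : 1 < k -> n <= f -> n <= g ->
  digits_rec k f n = digits_rec k g n.
Proof.
move=> k1; elim: f g n => [|f IHf] [|g] [|n] //= nf ng.
have lt_n : n.+1 %/ k < n.+1 by rewrite ltn_Pdiv.
by rewrite (IHf g) // -ltnS; apply: leq_trans lt_n _.
Qed.

Lemma digits_rcons k n d : 1 < k -> d < k -> 0 < n * k + d ->
  digits k (n * k + d) = rcons (digits k n) d.
Proof.
move=> k1 dk; rewrite /digits.
have /esym divE : n = (n * k + d) %/ k by rewrite divnMDl ?divn_small ?addn0 //; lia.
have /esym modE : d = (n * k + d) %% k by rewrite modnMDl modn_small.
case E: (n * k + d) divE modE => [//|m] divE modE _ /=; rewrite divE modE.
congr rcons; apply: digits_rec_fuel => //.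
by rewrite -ltnS -divE ltn_Pdiv.
Qed.

Lemma digit_word_rcons k n (d : 'I_k) : 1 < k -> 0 < n * k + d ->
  digit_word k (n * k + d) = rcons (digit_word k n) d.
Proof.
move=> k1 nd; rewrite /digit_word digits_rcons //.
by rewrite -cats1 pmap_cat /= valK /= cats1.
Qed.

Definition digit_sum (p n : nat) : nat := sumn (digits p n).

Lemma digit_sum_rcons p n d : 1 < p -> d < p ->
  digit_sum p (n * p + d) = digit_sum p n + d.
Proof.
move=> p1 dp; case: (posnP (n * p + d)) => [|nd].
  by move=> nd; have [-> ->] : n = 0 /\ d = 0 by nia.
by rewrite /digit_sum digits_rcons // sumn_rcons.
Qed.

Lemma digit_sum_divn p n : 1 < p ->
  digit_sum p n = digit_sum p (n %/ p) + n %% p.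
Proof.
by move=> p1; rewrite {1}(divn_eq n p) digit_sum_rcons ?ltn_mod //; lia.
Qed.

Lemma divn_ind p (p1 : 1 < p) (P : nat -> Prop) : P 0 ->
  (forall n, 0 < n -> P (n %/ p) -> P n) -> forall n, P n.
Proof.
move=> P0 Pn n; elim/ltn_ind: n => -[//|n] IH.
by apply: Pn => //; apply: IH; rewrite ltn_Pdiv.
Qed.

Lemma digit_sum_leq p n : 1 < p -> digit_sum p n <= n.
Proof.
move=> p1; elim/(@divn_ind p p1): n => // n n0 IH.
by rewrite digit_sum_divn //; have := divn_eq n p; nia.
Qed.

Lemma digit_sumS p n : 1 < p -> digit_sum p n.+1 <= (digit_sum p n).+1.
Proof.
move=> p1; elim/(@divn_ind p p1): n => [|n n0 IH]; first exact: digit_sum_leq.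
have nE := divn_eq n p; have lt_np : n %% p < p by rewrite ltn_mod; lia.
rewrite [digit_sum p n]digit_sum_divn //.
case: (ltnP (n %% p).+1 p) => lt_p.
  have -> : n.+1 = n %/ p * p + (n %% p).+1 by lia.
  by rewrite digit_sum_rcons //; lia.
have -> : n.+1 = (n %/ p).+1 * p + 0 by rewrite mulSn; lia.
by rewrite digit_sum_rcons //; lia.
Qed.

Lemma digit_sumD p m n : 1 < p ->
  digit_sum p (m + n) <= digit_sum p m + digit_sum p n.
Proof.
move=> p1; elim/(@divn_ind p p1): m n => [//|m m0 IH] n.
have [mE nE] := (divn_eq m p, divn_eq n p).
have lt_mp : m %% p < p by rewrite ltn_mod; lia.
have lt_np : n %% p < p by rewrite ltn_mod; lia.
rewrite [digit_sum p m]digit_sum_divn // [digit_sum p n]digit_sum_divn //.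
have := IH (n %/ p); case: (ltnP (m %% p + n %% p) p) => lt_p.
  have -> : m + n = (m %/ p + n %/ p) * p + (m %% p + n %% p) by rewrite mulnDl; lia.
  by rewrite digit_sum_rcons //; lia.
have -> : m + n = (m %/ p + n %/ p).+1 * p + (m %% p + n %% p - p).
  by rewrite mulSn mulnDl; lia.
rewrite digit_sum_rcons //; last by lia.
by have := digit_sumS (m %/ p + n %/ p) p1; lia.
Qed.

Lemma digit_sum_expn p N : 1 < p -> digit_sum p (p ^ N) = 1.
Proof.
move=> p1; elim: N => [|N IH]; first exact: (@digit_sum_rcons p 0 1).
by rewrite expnSr -[_ * p]addn0 digit_sum_rcons ?IH //; lia.
Qed.

Lemma digit_sum_div_expn p n i : 1 < p -> digit_sum p (n %/ p ^ i) <= digit_sum p n.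
Proof.
move=> p1; elim: i n => [|i IH] n; first by rewrite divn1.
rewrite expnS divnMA; apply: leq_trans (IH _) _.
by rewrite [digit_sum p n]digit_sum_divn // leq_addr.
Qed.

(** The divisibility forces the last [m] base-[p] digits of [n] to be [p - 1]. *)
Lemma digit_sum_pred_multiple p n m : 1 < p -> p ^ m %| n.+1 ->
  (p - 1) * m <= digit_sum p n.
Proof.
move=> p1; elim: m n => [|m IH] n; first by rewrite muln0.
rewrite expnSr => /dvdnP[y nE]; have y0 : 0 < y by case: y nE; lia.
have pm0 : 0 < p ^ m by rewrite expn_gt0; lia.
have nE' : n = (y * p ^ m).-1 * p + p.-1.
  have : 0 < y * p ^ m by rewrite muln_gt0 y0.
  by move: nE; rewrite mulnA; case: (y * p ^ m) => // x; rewrite mulSn /=; lia.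
rewrite nE' digit_sum_rcons //; last by lia.
have /IH : p ^ m %| (y * p ^ m).-1.+1 by rewrite prednK ?dvdn_mull // muln_gt0 y0.
by rewrite mulnS; lia.
Qed.

Lemma digit_sum_ltn_expn p n L : 1 < p -> n < p ^ L -> digit_sum p n <= (p - 1) * L.
Proof.
move=> p1; elim: L n => [|L IH] n; first by case: n.
rewrite expnSr => nL; rewrite digit_sum_divn // mulnS.
have := IH (n %/ p); rewrite ltn_divLR; last by lia.
move/(_ nL); have lt_np : n %% p < p by rewrite ltn_mod; lia.
lia.
Qed.

Lemma digit_sum_leq_divn p n i : 1 < p -> digit_sum p n <= n %/ p ^ i + i * p.
Proof.
move=> p1; elim: i n => [|i IH] n; first by rewrite divn1 addn0 digit_sum_leq.
rewrite digit_sum_divn // expnS divnMA mulSn.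
have lt_np : n %% p < p by rewrite ltn_mod; lia.
by have := IH (n %/ p); lia.
Qed.

Lemma digit_sum_small p C : 1 < p -> exists N, forall n, N <= n -> C * digit_sum p n <= n.
Proof.
(* Since [i < p ^ i], the high part contributes [i * (n %/ p ^ i) <= n]; the threshold makes the low
   part [i * (i * p) <= n]. The factor 2 in [i] absorbs the sum of the two. *)
move=> p1; set i := 2 * C; exists (i * (i * p)) => n nN.
have H1 := digit_sum_leq_divn n i p1.
have H2 : i * (n %/ p ^ i) <= n.
  apply: leq_trans (leq_divM n (p ^ i)).
  by rewrite mulnC leq_mul2l (ltnW (ltn_expl i p1)) orbT.
have : i * digit_sum p n <= i * (n %/ p ^ i + i * p) by rewrite leq_mul2l H1 orbT.
by rewrite mulnDr /i -!mulnA in H2 nN *; lia.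
Qed.

(** * Automata *)

(** Positivity of [n] and [m] matters: 0 is the empty word, so appending the digit 0 to it is not a
    transition. *)
Lemma automatic_state (T : eqType) k (a : nat -> T) : 1 < k -> automatic k a ->
  exists (S : finType) (st : nat -> S) (out : S -> T), (forall n, a n = out (st n)) /\
    (forall n m d, d < k -> 0 < n -> 0 < m -> st n = st m ->
       st (n * k + d) = st (m * k + d)).
Proof.
move=> k1 [M Ma]; exists (dfao_state M).
exists (fun n => foldl (@dfao_trans _ _ M) (dfao_start M) (digit_word k n)).
exists (@dfao_out _ _ M); split=> // n m d dk n0 m0 stE.
have k0 : 0 < k by lia.
rewrite -[d]/(val (Ordinal dk)) !digit_word_rcons ?addn_gt0 ?muln_gt0 ?n0 ?m0 ?k0 //.
by rewrite !foldl_rcons stE.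
Qed.

(** Both words end with the same [t] digits, those of [j] padded with zeros, so equal states remain
    equal. *)
Lemma automatic_block (T : eqType) k (a : nat -> T) : 1 < k -> automatic k a ->
  exists (S : finType) (st : nat -> S), forall n m t j, 0 < n -> 0 < m -> j < k ^ t ->
    st n = st m -> a (n * k ^ t + j) = a (m * k ^ t + j).
Proof.
move=> k1 /(automatic_state k1)[S [st [out [aE stE]]]]; exists S, st.
move=> n m t j n0 m0 jt nm; rewrite !aE; congr out.
elim: t j jt => [|t IH] j; first by case: j => //; rewrite !muln1 !addn0.
have kt : 0 < k ^ t by rewrite expn_gt0; lia.
rewrite expnSr => jt; have k0 : 0 < k by lia.
have step x : x * (k ^ t * k) + j = (x * k ^ t + j %/ k) * k + j %% k.
  by rewrite mulnDl {1}(divn_eq j k) mulnA addnA.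
rewrite !step; apply: stE; rewrite ?ltn_mod ?addn_gt0 ?muln_gt0 ?n0 ?m0 ?kt //.
by apply: IH; rewrite ltn_divLR.
Qed.

Lemma not_automatic_gaps (T : eqType) k (a : nat -> T) (W : T -> Prop) : 1 < k ->
  (forall n, 0 < n -> exists t0, forall t, t0 <= t ->
     exists2 j, j < k ^ t & W (a (n * k ^ t + j))) ->
  (forall t, exists2 n, 0 < n & forall j, j < k ^ t -> ~ W (a (n * k ^ t + j))) ->
  ~ automatic k a.
Proof.
move=> k1 hits gaps /(automatic_block k1)[S [st stE]].
(* The threshold of one [n] serves every number in the same state; as states are finitely many, the
   maximum serves all [n] at once. *)
have /fin_all_exists[t0 t0P] (q : S) : exists t0, forall n, 0 < n -> st n = q ->
    forall t, t0 <= t -> exists2 j, j < k ^ t & W (a (n * k ^ t + j)).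
  case: (classic (exists2 n, 0 < n & st n = q)) => [[n n0 nq]|no_n].
    have [t0 t0P] := hits n n0; exists t0 => m m0 mq t tt0.
    by have [j jt Wj] := t0P t tt0; exists j => //; rewrite (stE m n) // mq.
  by exists 0 => n n0 nq; case: no_n; exists n.
have [n n0 nW] := gaps (\max_q t0 q).
have [j jt Wj] := t0P (st n) n n0 erefl (\max_q t0 q) (leq_bigmax (st n)).
exact: nW Wj.
Qed.

(** The values of [f] serve as the states: [fS] makes the transitions well defined on them, [fa] the
    output. *)
Lemma automatic_congruence (T : eqType) k (a : nat -> T) (S : finType) (f : nat -> S) :
  1 < k ->
  (forall n m d, d < k -> f n = f m -> f (n * k + d) = f (m * k + d)) ->
  (forall n m, f n = f m -> a n = a m) ->
  automatic k a.
Proof.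
move=> k1 fS fa.
(* Outside the image of [f], outputs and transitions take arbitrary default values. *)
have /fin_all_exists[out outE] (q : S) : exists y, forall n, f n = q -> a n = y.
  case: (classic (exists n, f n = q)) => [[n nq]|no_n].
    by exists (a n) => m mq; apply: fa; rewrite mq.
  by exists (a 0) => n nq; case: no_n; exists n.
have /fin_all_exists[tr trE] (x : S * 'I_k) :
    exists y, forall n, f n = x.1 -> f (n * k + x.2) = y.
  case: (classic (exists n, f n = x.1)) => [[n nq]|no_n].
    by exists (f (n * k + x.2)) => m mq; apply: fS => //; rewrite mq.
  by exists (f 0) => n nq; case: no_n; exists n.
exists (@DFAO _ T S (fun q d => tr (q, d)) (f 0) (codom out) out (codom_f out)) => n.
rewrite /dfao_run /=; apply: outE.
suff run w m : foldl (fun q d => tr (q, d)) (f m) w =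
    f (foldl (fun x d => x * k + d) m [seq val d | d <- w]).
  by rewrite run digit_wordE ?digitsK.
by elim: w m => //= d w IH m; rewrite -IH (trE (f m, d) m).
Qed.

(** * Factorials and Legendre's formula *)

(** For prime [p] this is, up to sign, Morita's p-adic gamma function at [n + 1]. *)
Definition coprime_fact (p n : nat) : nat := \prod_(1 <= j < n.+1 | ~~ (p %| j)) j.

Lemma coprime_fact0 p : coprime_fact p 0 = 1.
Proof. by rewrite /coprime_fact big_geq. Qed.

Lemma coprime_factS p n : coprime_fact p n.+1 =
  coprime_fact p n * (if p %| n.+1 then 1 else n.+1).
Proof.
rewrite /coprime_fact big_mkcond big_nat_recr //= -big_mkcond.
by case: (p %| n.+1).
Qed.

Lemma coprime_fact_coprime p n : prime p -> coprime p (coprime_fact p n).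
Proof.
move=> pp; elim: n => [|n IH]; first by rewrite coprime_fact0 coprimen1.
rewrite coprime_factS coprimeMr IH; case: ifP => pn; first by rewrite coprimen1.
by rewrite prime_coprime // pn.
Qed.

(** The multiples of [p] up to [n] are the [p * j] with [j <= n %/ p]. *)
Lemma fact_divn p n : prime p ->
  n`! = p ^ (n %/ p) * (n %/ p)`! * coprime_fact p n.
Proof.
move=> pp; elim: n => [|n IH]; first by rewrite div0n coprime_fact0.
rewrite factS coprime_factS divnS ?prime_gt0 //; case: ifP => [/dvdnP[y nE]|pn].
  have yE : n %/ p = y.-1.
    move: (divnS n (prime_gt0 pp)); rewrite nE dvdn_mull // mulnK ?prime_gt0 //.
    by move->.
  case: y nE yE => // y nE /= yE.
  by rewrite nE IH yE add1n expnS factS; lia.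
by rewrite add0n IH; lia.
Qed.

Lemma logn_fact_divn p n : prime p -> logn p n`! = n %/ p + logn p (n %/ p)`!.
Proof.
move=> pp; have cop := coprime_fact_coprime n pp.
have g0 : 0 < coprime_fact p n.
  case: (coprime_fact p n) cop => //; rewrite /coprime gcdn0 => /eqP p1.
  by rewrite p1 in pp.
have pk0 : 0 < p ^ (n %/ p) by rewrite expn_gt0 prime_gt0.
rewrite {1}(fact_divn n pp) !lognM ?muln_gt0 ?pk0 ?fact_gt0 //.
by rewrite pfactorK // [logn p (coprime_fact p n)]logn_coprime // addn0.
Qed.

Lemma legendre p n : prime p -> (p - 1) * logn p n`! + digit_sum p n = n.
Proof.
move=> pp; have p1 := prime_gt1 pp; elim/(@divn_ind p p1): n => [|n n0 IH].
  by rewrite fact0 logn1 muln0.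
have kE : (p - 1) * (n %/ p) + n %/ p = n %/ p * p by nia.
by rewrite logn_fact_divn // digit_sum_divn // mulnDr; have := divn_eq n p; lia.
Qed.

Definition fact_unit (p n : nat) : nat := n`! %/ p ^ logn p n`!.

Lemma fact_unitE p n : n`! = p ^ logn p n`! * fact_unit p n.
Proof. by rewrite mulnC divnK // pfactor_dvdnn. Qed.

Lemma fact_unit_divn p n : prime p ->
  fact_unit p n = fact_unit p (n %/ p) * coprime_fact p n.
Proof.
move=> pp; have pk0 : 0 < p ^ logn p n`! by rewrite expn_gt0 prime_gt0.
apply/eqP; rewrite -(eqn_pmul2l pk0) -fact_unitE {1}(fact_divn n pp).
by rewrite {1}(fact_unitE p (n %/ p)) (logn_fact_divn n pp) expnD !mulnA eqxx.
Qed.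

(** The numbers [m + j] and [j] agree modulo [m], hence are divisible by [p] together. *)
Lemma coprime_factD p m n : p %| m ->
  coprime_fact p (m + n) = coprime_fact p m * coprime_fact p n %[mod m].
Proof.
move=> pm; elim: n => [|n IH]; first by rewrite addn0 coprime_fact0 muln1.
rewrite addnS !coprime_factS -addnS dvdn_addr // mulnA -modnMml IH modnMml.
by case: ifP => // _; rewrite -modnMmr modnDl modnMmr.
Qed.

(** Each stretch of [p ^ k.+1] factors contributes the same unit, and by Euler [totient (p ^ k.+1)]
    copies of it cancel. *)
Lemma coprime_fact_period p k n y : prime p ->
  coprime_fact p (y * (totient (p ^ k.+1) * p ^ k.+1) + n) =
  coprime_fact p n %[mod p ^ k.+1].
Proof.
move=> pp; set m := p ^ k.+1; have pm : p %| m by rewrite /m expnS dvdn_mulr.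
have mul_m x i : coprime_fact p (x * m + i) =
    coprime_fact p m ^ x * coprime_fact p i %[mod m].
  elim: x => [|x IH]; first by rewrite mul1n.
  by rewrite mulSn -addnA coprime_factD // -modnMmr IH modnMmr expnS mulnA.
rewrite mulnA mul_m mulnC [y * _]mulnC expnM -modnMmr -modnXm.
rewrite Euler_exp_totient; last first.
  by rewrite coprime_sym /m coprimeXl // coprime_fact_coprime.
by rewrite modnXm exp1n modnMmr muln1.
Qed.

Lemma coprime_fact_congr p k m n : prime p ->
  m = n %[mod totient (p ^ k.+1) * p ^ k.+1] ->
  coprime_fact p m = coprime_fact p n %[mod p ^ k.+1].
Proof.
move=> pp; set D := _ * _ => mn.
by rewrite (divn_eq m D) (divn_eq n D) !coprime_fact_period // mn.
Qed.

(** * Comparing digit sums in two bases *)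

(** Binomial expansion: the terms of order at least 2 are multiples of [m * m]. *)
Lemma expn_add1_mod m w x : (1 + m * w) ^ x = 1 + x * (m * w) %[mod m * m].
Proof.
elim: x => [|x IH]; first by rewrite mul0n.
rewrite expnS -modnMmr IH modnMmr.
have -> : (1 + m * w) * (1 + x * (m * w)) = (x * w * w) * (m * m) + (1 + x.+1 * (m * w)).
  by nia.
by rewrite modnMDl.
Qed.

(* If [p ^ D = 1 + q ^ M w] with [w] prime to [q], the powers of [p ^ D] reach,
   modulo [q ^ (2 M)], every residue congruent to 1 modulo [q ^ M]. *)
Lemma expn_opp_residue p q M0 : 1 < p -> prime q -> coprime q p ->
  exists N M, M0 <= M /\ q ^ M * q ^ M %| p ^ N + q ^ M - 1.
Proof.
move=> p1 pq cop; set D := totient (q ^ M0.+1).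
have D0 : 0 < D by rewrite totient_gt0 expn_gt0 prime_gt0.
have pD1 : 1 < p ^ D by rewrite -[1](exp1n D) ltn_exp2r.
have qD : q ^ M0.+1 %| p ^ D - 1.
  rewrite -eqn_mod_dvd ?(ltnW pD1) //; apply/eqP; apply: Euler_exp_totient.
  by rewrite coprimeXr // coprime_sym.
have pD0 : 0 < p ^ D - 1 by rewrite subn_gt0.
have [w cw wE] := pfactor_coprime pq pD0; move: wE; set M := logn _ _ => wE.
have MM : M0 < M by rewrite -pfactor_dvdn.
set m := q ^ M in wE *; have m0 : 0 < m by rewrite expn_gt0 prime_gt0.
have pDE : p ^ D = 1 + m * w by move: wE pD1; rewrite mulnC; lia.
(* The exponent [x] is minus the inverse of [w] modulo [m]: by Euler [w ^ (totient m).-1] is the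
   inverse, and [m - 1] stands for -1. *)
have xw : m %| w ^ (totient m).-1 * (m - 1) * w + 1.
  have -> : w ^ (totient m).-1 * (m - 1) * w = w ^ totient m * (m - 1).
    by rewrite mulnAC -expnSr prednK // totient_gt0.
  rewrite /dvdn -modnDml -modnMml Euler_exp_totient; last first.
    by rewrite coprime_sym coprimeXl.
  by rewrite modnMml mul1n modnDml subnK // modnn.
set x := w ^ _ * _ in xw; exists (D * x), M; split; first exact: ltnW.
have N0 : 0 < p ^ (D * x) by rewrite expn_gt0; lia.
rewrite -/m -addnBA // /dvdn expnM pDE -modnDml expn_add1_mod modnDml.
have -> : 1 + x * (m * w) + (m - 1) = m * (x * w + 1).
  by rewrite mulnDr muln1 mulnCA; clear -m0; lia.
exact: dvdn_mul.
Qed.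

Lemma digit_sum_gap p q k c t : 1 < p -> prime q -> coprime q p -> 0 < k ->
  exists2 n, 0 < n & forall j, j < k ^ t ->
    digit_sum p (n * k ^ t + j) + c <= digit_sum q (n * k ^ t + j).
Proof.
move=> p1 pq cop k0; set B := k ^ t; have B0 : 0 < B by rewrite expn_gt0 k0.
have q1 := prime_gt1 pq.
(* The block lies at distance less than [2 * B] above [z], so base-[p] digit sums are at most
   [2 * B] there; the bound on [M] beats this by [c] and excludes a carry past [q ^ M]. *)
have [N [M [MB]]] := expn_opp_residue (2 * B + c + 1) p1 pq cop.
set m := q ^ M; set z := p ^ N => /dvdnP[y zE].
have Mm : M < m by apply: ltn_expl.
have z0 : 0 < z by rewrite expn_gt0; lia.
have y0 : 0 < y by case: y zE; lia.
exists (z %/ B).+1 => // j jB.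
have [i iE i2] : exists2 i, (z %/ B).+1 * B + j = z + i & i < 2 * B.
  exists (B - z %% B + j); have := divn_eq z B; have := ltn_pmod z B0;
  by rewrite ?mulSn; lia.
(* As [z = y * m ^ 2 - m + 1], dropping the last [M] base-[q] digits leaves a number ending in [M]
   digits [q - 1]. *)
rewrite iE; have zi : (z + i) %/ m = (y * m).-1.
  have -> : z + i = (y * m).-1 * m + (1 + i).
    have : 0 < y * m by rewrite muln_gt0 y0; lia.
    by move: zE; rewrite mulnA; case: (y * m) => // u; rewrite mulSn /=; lia.
  by rewrite divnMDl ?divn_small ?addn0 //; lia.
have Sp : digit_sum p (z + i) <= 1 + i.
  apply: leq_trans (digit_sumD _ _ p1) _.
  by rewrite digit_sum_expn // leq_add2l digit_sum_leq.
have Sq : (q - 1) * M <= digit_sum q (z + i).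
  apply: leq_trans (digit_sum_div_expn (z + i) M q1); rewrite -/m zi.
  apply: digit_sum_pred_multiple => //; rewrite prednK ?dvdn_mull //.
  by rewrite muln_gt0 y0; lia.
have : 1 * M <= (q - 1) * M by rewrite leq_mul2r; lia.
by lia.
Qed.

(** The inductive step amounts to [P.+1 * m.+1 <= P * m.+2], that is, [m.+1 <= P]. *)
Lemma ltn_expS P m : 1 < P -> 0 < m -> m <= P -> P.+1 ^ m < m.+1 * P ^ m.
Proof.
move=> P1; elim: m => // -[|m] IH _ mP; first by rewrite !expn1; lia.
have {IH} := IH isT (ltnW mP); rewrite [P.+1 ^ m.+2]expnS [P ^ m.+2]expnS.
have : 0 < P ^ m.+1 by rewrite expn_gt0; lia.
by nia.
Qed.

(** By induction on [P]: raising [P] by one multiplies the right side by [q] and the left side, by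
    [ltn_expS], by less than [q]. *)
Lemma ltn_exp_base q P : 1 < q -> q < P -> P ^ (q - 1) < q ^ (P - 1).
Proof.
move=> q1; have qE : (q - 1).+1 = q by lia.
elim: P => // P IH; rewrite ltnS leq_eqVlt subSS subn0 => /orP[/eqP<-|qP].
  have : q.+1 ^ (q - 1) < (q - 1).+1 * q ^ (q - 1) by apply: ltn_expS; lia.
  by rewrite qE -expnS qE.
have : P.+1 ^ (q - 1) < (q - 1).+1 * P ^ (q - 1) by apply: ltn_expS; lia.
move/ltn_trans; apply; rewrite qE -[in q ^ P](subnK (_ : 0 < P)); last by lia.
by rewrite addn1 expnS ltn_mul2l IH // andbT; lia.
Qed.

(** A larger digit sum would need [L] base-[q] digits with [(P - 1) * K < (q - 1) * L]. Comparing
    sizes then gives [(q ^ (P - 1)) ^ L <= C * A ^ L], which bounds [L], hence [K], because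
    [A < q ^ (P - 1)]. *)
Lemma digit_sum_smaller_base q P H : 1 < q -> q < P ->
  exists K0, forall K n, K0 <= K -> n < H * P ^ K -> digit_sum q n <= (P - 1) * K.
Proof.
move=> q1 qP; set A := P ^ (q - 1); set C := (q * H) ^ (P - 1).
exists ((q - 1) * (C * A)) => K n KK nH.
case: (posnP n) => [->//|n0]; case: leqP => // ltS.
have A0 : 0 < A by rewrite expn_gt0; lia.
set L := (trunc_log q n).+1.
have SL : digit_sum q n <= (q - 1) * L.
  by apply: digit_sum_ltn_expn => //; apply: trunc_log_ltn.
have qL : q ^ L <= q * H * P ^ K.
  by rewrite /L expnS -mulnA leq_mul2l (leq_trans (trunc_logP q1 n0) (ltnW nH)) orbT.
have bigL : (q ^ (P - 1)) ^ L <= C * A ^ L.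
  rewrite -expnM mulnC expnM; apply: leq_trans (_ : (q * H * P ^ K) ^ (P - 1) <= _).
    by rewrite leq_exp2r //; lia.
  rewrite expnMn -/C leq_mul2l -!expnM leq_exp2l; last by lia.
  by rewrite [K * _]mulnC (ltnW (leq_trans ltS SL)) orbT.
(* Bernoulli's inequality for [A.+1 ^ L], in a form free of division. *)
have AL : A ^ L + L * A ^ L.-1 <= (q ^ (P - 1)) ^ L.
  apply: leq_trans (_ : A.+1 ^ L <= _); last first.
    by rewrite leq_exp2r // ltn_exp_base.
  rewrite /L /=; elim: (trunc_log q n) => [|l IHl]; first by rewrite !expn1; lia.
  rewrite [A.+1 ^ _]expnS; apply: leq_trans (leq_mul (leqnn A.+1) IHl).
  by rewrite [A ^ l.+2]expnS [A ^ l.+1]expnS; nia.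
have LC : L <= C * A.
  have := leq_trans AL bigL; rewrite /L [A ^ _.+1]expnS /= => H1.
  have Al0 : 0 < A ^ trunc_log q n by rewrite expn_gt0 A0.
  rewrite -(leq_pmul2r Al0) -mulnA.
  exact: leq_trans (leq_addl _ _) H1.
have : (q - 1) * L <= (q - 1) * (C * A) by rewrite leq_mul2l LC orbT.
have : 1 * K <= (P - 1) * K by rewrite leq_mul2r; lia.
by lia.
Qed.

Lemma pred_multiple_in_block P k n0 K0 : 1 < P -> 1 < k -> exists t0, forall t, t0 <= t ->
  exists j K, [/\ j < k ^ t, K0 <= K, P ^ K %| (n0 * k ^ t + j).+1 &
                  n0 * k ^ t + j < 2 * (P * n0 + 1) * P ^ K].
Proof.
(* From [t < k ^ t] this threshold yields [P ^ K0 <= B %/ 2], whence [K0 <= K]. *)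
move=> P1 k1; exists (2 * P ^ K0) => t tt.
set B := k ^ t; have tB : t < B by apply: ltn_expl.
have P0 : 0 < P ^ K0 by rewrite expn_gt0; lia.
have B2 : 0 < B %/ 2 by lia.
set K := trunc_log P (B %/ 2).
have KB : P ^ K <= B %/ 2 by apply: trunc_logP.
have BK : B %/ 2 < P ^ K * P by rewrite -expnSr; apply: trunc_log_ltn.
have K0K : K0 <= K by apply: trunc_log_max => //; lia.
(* Cancelling the remainder makes the successor a multiple of [P ^ K]; [2 * P ^ K <= B] keeps the
   offset inside the block. *)
exists (2 * P ^ K - 1 - (n0 * B) %% P ^ K), K.
have PK0 : 0 < P ^ K by rewrite expn_gt0; lia.
have lt_mod := ltn_pmod (n0 * B) PK0; have nE := divn_eq (n0 * B) (P ^ K).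
split=> //; first by lia.
  have -> : (n0 * B + (2 * P ^ K - 1 - (n0 * B) %% P ^ K)).+1 =
      ((n0 * B) %/ P ^ K + 2) * P ^ K.
    by rewrite mulnDl; lia.
  exact: dvdn_mull.
have : n0 * B <= n0 * (2 * (P ^ K * P)) by rewrite leq_mul2l; apply/orP; right; lia.
by nia.
Qed.

(** * The last nonzero digit of a factorial *)

Lemma dvdn_prod_coprime (I : eqType) (s : seq I) (C : pred I) (F : I -> nat) x :
  uniq s -> {in s &, forall i j, i != j -> coprime (F i) (F j)} ->
  (forall i, i \in s -> C i -> F i %| x) -> \prod_(i <- s | C i) F i %| x.
Proof.
elim: s => [|i s IH] /=; first by rewrite big_nil dvd1n.
move=> /andP[i_s s_uniq] cop Fx; rewrite big_cons.
have Fs : \prod_(j <- s | C j) F j %| x.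
  apply: IH => // [j l js ls|j js]; first by apply: cop; rewrite in_cons ?js ?ls orbT.
  by apply: Fx; rewrite in_cons js orbT.
case: ifP => // Ci; rewrite Gauss_dvd ?Fs ?Fx ?mem_head //.
rewrite big_seq_cond; apply: (big_ind (coprime (F i))) => [|y z iy iz|j /andP[js _]].
- exact: coprimen1.
- by rewrite coprimeMr iy.
- apply: cop; rewrite ?mem_head ?in_cons ?js ?orbT //.
  by apply: contraNneq i_s => ->.
Qed.

Lemma modn_cancel d x m n : coprime d x -> x * m = x * n %[mod d] -> m = n %[mod d].
Proof.
move=> cop; wlog le_nm : m n / n <= m => [IH|].
  by case: (leqP n m) => [/IH//|/ltnW/IH H /esym/H].
move/eqP; rewrite eqn_mod_dvd ?leq_mul2l ?le_nm ?orbT // -mulnBr Gauss_dvdr //.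
by rewrite -eqn_mod_dvd // => /eqP.
Qed.

(** A counter capped at [N] is thus an admissible component of an automaton state; it singles out
    the numbers below [N]. *)
Lemma minn_congr k m n d N : 0 < k -> minn m N = minn n N ->
  minn (m * k + d) N = minn (n * k + d) N.
Proof.
move=> k0 mn; case: (ltnP m N) => mN; first by have -> : m = n by lia.
have nN : N <= n by lia.
have leM x : N <= x -> N <= x * k + d.
  by move=> Nx; apply: leq_trans (leq_addr _ _); apply: leq_trans (leq_pmulr _ k0).
by rewrite !(minn_idPr _) ?leM.
Qed.

Lemma eventually_forall r (A : nat -> nat -> Prop) :
  (forall j, 1 <= j <= r -> exists N, forall n, N <= n -> A j n) ->
  exists N, forall n, N <= n -> forall j, 1 <= j <= r -> A j n.
Proof.
elim: r => [|r IH] ev; first by exists 0 => n _ [|j].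
have [|N1 N1P] := IH; first by move=> j jr; apply: ev; lia.
have [|N2 N2P] := ev r.+1; first by lia.
exists (maxn N1 N2) => n; rewrite geq_max => /andP[n1 n2] j jr.
by case: (eqVneq j r.+1) => [->|j_r]; [apply: N2P|apply: N1P => //; lia].
Qed.

Section Factorization.

Variables (b r : nat) (p a : nat -> nat).
Hypothesis b_ge2 : 2 <= b.
Hypothesis p_prime : forall i, 1 <= i <= r -> prime (p i).
Hypothesis p_distinct :
  forall i j, 1 <= i <= r -> 1 <= j <= r -> p i = p j -> i = j.
Hypothesis a_ge1 : forall i, 1 <= i <= r -> 1 <= a i.
Hypothesis b_fact : b = \prod_(1 <= i < r.+1) p i ^ a i.

Local Notation c i := (a i * (p i - 1)).
Local Notation bval n := (base_val b n`!).
Local Notation quot n := (n`! %/ b ^ bval n).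

Let cofactor i := \prod_(1 <= j < r.+1 | j != i) p j ^ a j.

Lemma coprime_primes i j : 1 <= i <= r -> 1 <= j <= r -> i != j -> coprime (p i) (p j).
Proof.
move=> ir jr ij; rewrite prime_coprime ?p_prime // dvdn_prime2 ?p_prime //.
by apply: contraNneq ij => /p_distinct->.
Qed.

Lemma factor_cofactor i : 1 <= i <= r -> b = p i ^ a i * cofactor i.
Proof.
move=> ir; rewrite b_fact (bigD1_seq i) ?iota_uniq //=.
by rewrite mem_index_iota ltnS.
Qed.

Lemma coprime_cofactor i k : 1 <= i <= r -> coprime (p i ^ k) (cofactor i).
Proof.
move=> ir; apply: coprimeXl; rewrite /cofactor big_seq_cond.
apply: (big_ind (coprime (p i))) => [|y z iy iz|j]; first exact: coprimen1.
  by rewrite coprimeMr iy.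
rewrite mem_index_iota ltnS => /andP[jr ji].
by apply: coprimeXr; apply: coprime_primes; rewrite // eq_sym.
Qed.

Lemma prime_power_dvdn_fact i t n : 1 <= i <= r ->
  (p i ^ (a i * t) %| n`!) = (c i * t + digit_sum (p i) n <= n).
Proof.
move=> ir; have pp := p_prime ir; rewrite pfactor_dvdn ?fact_gt0 //.
have p1 : 0 < p i - 1 by rewrite subn_gt0 prime_gt1.
rewrite -{3}(legendre n pp) leq_add2r [a i * (p i - 1)]mulnC -mulnA.
by rewrite leq_pmul2l.
Qed.

Lemma base_val_factP n t :
  (t <= bval n) <-> (forall i, 1 <= i <= r -> c i * t + digit_sum (p i) n <= n).
Proof.
rewrite -base_valP ?fact_gt0 //; split=> [bt i ir|H].
  rewrite -prime_power_dvdn_fact // expnM; apply: dvdn_trans bt.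
  by apply: dvdn_exp2r; rewrite (factor_cofactor ir) dvdn_mulr.
rewrite b_fact (big_morph (expn^~ t) (fun x y => expnMn x y t) (exp1n t)).
apply: dvdn_prod_coprime => [|i j|i]; first exact: iota_uniq.
  rewrite !mem_index_iota !ltnS => ir jr ij.
  by rewrite -!expnM coprimeXl // coprimeXr // coprime_primes.
by rewrite mem_index_iota ltnS => ir _; rewrite -expnM prime_power_dvdn_fact // H.
Qed.

Lemma base_expn_dvdn_fact n : b ^ bval n %| n`!.
Proof. by rewrite base_valP ?fact_gt0. Qed.

Lemma prime_power_dvdn_quot i n : 1 <= i <= r ->
  (p i ^ a i %| quot n) = (c i * (bval n).+1 + digit_sum (p i) n <= n).
Proof.
move=> ir; rewrite -prime_power_dvdn_fact // dvdn_divRL ?base_expn_dvdn_fact //.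
have bE : b ^ bval n = p i ^ (a i * bval n) * cofactor i ^ bval n.
  by rewrite {1}(factor_cofactor ir) expnMn expnM.
rewrite bE mulnA -expnD -mulnS Gauss_dvd; last by rewrite coprimeXr ?coprime_cofactor.
have -> : cofactor i ^ bval n %| n`!; last by rewrite andbT.
by apply: dvdn_trans (base_expn_dvdn_fact n); rewrite bE dvdn_mull.
Qed.

Lemma prime_power_dvdn_last_digit i n : 1 <= i <= r ->
  (p i ^ a i %| last_nonzero_digit b n`!) =
  (c i * (bval n).+1 + digit_sum (p i) n <= n).
Proof.
move=> ir; rewrite -prime_power_dvdn_quot // /last_nonzero_digit.
by rewrite /dvdn modn_dvdm // (factor_cofactor ir) dvdn_mulr.
Qed.

(** At [bval n] the inequality of index [j] holds; its larger digit sum leaves index [i] room for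
    one more [c i]. *)
Lemma last_digit_gap i j n : 1 <= i <= r -> 1 <= j <= r -> c i = c j ->
  digit_sum (p i) n + c i <= digit_sum (p j) n ->
  p i ^ a i %| last_nonzero_digit b n`!.
Proof.
move=> ir jr cij Sij; rewrite prime_power_dvdn_last_digit // mulnS.
have /base_val_factP/(_ j jr) := leqnn (bval n); rewrite -cij; lia.
Qed.

Lemma last_digit_hit i n : 1 <= i <= r ->
  (forall j, 1 <= j <= r -> c j = c i -> digit_sum (p j) n <= digit_sum (p i) n) ->
  (forall j, 1 <= j <= r -> c j <> c i -> c j < c i /\ c i * digit_sum (p j) n <= n) ->
  ~~ (p i ^ a i %| last_nonzero_digit b n`!).
Proof.
move=> ir tie notie; rewrite prime_power_dvdn_last_digit //; apply/negP => Hi.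
suff : (bval n).+1 <= bval n by rewrite ltnn.
apply/base_val_factP => j jr; case: (c j =P c i) => [cji|/(notie j jr)[lt_c Sj]].
  by rewrite cji; apply: leq_trans Hi; rewrite leq_add2l tie.
have c0 : 0 < c i by apply: leq_trans lt_c.
rewrite -(leq_pmul2l c0) mulnDr.
set e := (bval n).+1 in Hi *; set C := c i in lt_c Sj c0 Hi *.
(* Here [c j <= C - 1] and [C * e <= n]; the spare [n] pays for [C * digit_sum (p j) n]. *)
have Hj : c j * (C * e) <= (C - 1) * n by apply: leq_mul; lia.
by nia.
Qed.

Lemma last_digit_dominant i : 1 <= i <= r ->
  (forall j, 1 <= j <= r -> j <> i -> c j < c i) ->
  exists N, forall n, N <= n ->
    bval n = logn (p i) n`! %/ a i /\ cofactor i %| quot n.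
Proof.
move=> ir dom; set C := c i in dom.
(* The factor 2 saves half of [n] for the extra [C * c j] caused by [t.+1] in [bound]; the term
   [2 * C * C] of the threshold covers it. *)
have [N NP] : exists N, forall n, N <= n -> forall j, 1 <= j <= r ->
    2 * C * digit_sum (p j) n <= n.
  apply: eventually_forall => j jr.
  by apply: digit_sum_small; apply: prime_gt1; apply: p_prime.
exists (N + 2 * C * C) => n nN; have {}NP := NP n (leq_trans (leq_addr _ _) nN).
have bound t j : C * t <= n -> 1 <= j <= r -> j <> i ->
    c j * t.+1 + digit_sum (p j) n <= n.
  move=> Ct jr ji; have lt_c := dom j jr ji; have Sj := NP j jr.
  have C0 : 0 < C by apply: leq_trans lt_c.
  rewrite -(leq_pmul2l C0) mulnDr mulnS mulnDr.
  have Hj : c j * (C * t) <= (C - 1) * n by apply: leq_mul; lia.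
  have Hc : C * c j <= C * C by rewrite leq_mul2l (ltnW lt_c) orbT.
  by nia.
have Cval : C * bval n <= n.
  have /base_val_factP/(_ i ir) := leqnn (bval n); rewrite -/C; lia.
split; last first.
  apply: dvdn_prod_coprime => [|j l|j]; first exact: iota_uniq.
    rewrite !mem_index_iota !ltnS => jr lr jl.
    by rewrite coprimeXl // coprimeXr // coprime_primes.
  rewrite mem_index_iota ltnS => jr /eqP ji.
  by rewrite prime_power_dvdn_quot //; apply: bound.
have a0 := a_ge1 ir; apply/eqP; rewrite eqn_leq; apply/andP; split.
  rewrite leq_divRL // mulnC -pfactor_dvdn ?fact_gt0 ?p_prime //.
  rewrite prime_power_dvdn_fact //.
  by have /base_val_factP/(_ i ir) := leqnn (bval n).
set t := _ %/ _; have Hi : C * t + digit_sum (p i) n <= n.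
  rewrite -prime_power_dvdn_fact // pfactor_dvdn ?fact_gt0 ?p_prime //.
  by rewrite mulnC leq_divM.
apply/base_val_factP => j jr; case: (j =P i) => [->//|ji].
by apply: leq_trans (bound t j _ jr ji); [rewrite leq_add2r leq_mul2l leqnSn orbT|lia].
Qed.

(** Factor [n!] through [b ^ bval n] and through the full power of [p i], then cancel
    [p i ^ (a i * bval n)]. *)
Lemma quot_fact_unit i n : 1 <= i <= r -> bval n = logn (p i) n`! %/ a i ->
  cofactor i ^ bval n * quot n = p i ^ (logn (p i) n`! %% a i) * fact_unit (p i) n.
Proof.
move=> ir valE.
have pk0 : 0 < p i ^ (a i * bval n) by rewrite expn_gt0 prime_gt0 ?p_prime.
apply/eqP; rewrite -(eqn_pmul2l pk0) mulnA expnM -expnMn -(factor_cofactor ir).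
rewrite mulnC divnK ?base_expn_dvdn_fact // -expnM mulnA -expnD valE mulnC.
by rewrite [a i * _]mulnC -divn_eq mulnC -fact_unitE.
Qed.

(** By the Chinese remainder theorem only the residue modulo [p i ^ a i] is at stake. The modulus
    [a i * totient (p i ^ a i)] fixes both the leftover exponent of [p i] and, through Euler, the
    power of the cofactor. *)
Lemma last_digit_congr i m n : 1 <= i <= r ->
  bval m = logn (p i) m`! %/ a i -> cofactor i %| quot m ->
  bval n = logn (p i) n`! %/ a i -> cofactor i %| quot n ->
  logn (p i) m`! = logn (p i) n`! %[mod a i * totient (p i ^ a i)] ->
  fact_unit (p i) m = fact_unit (p i) n %[mod p i ^ a i] ->
  last_nonzero_digit b m`! = last_nonzero_digit b n`!.
Proof.
move=> ir vm qm vn qn log_mn unit_mn; rewrite /last_nonzero_digit; apply/eqP.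
rewrite {3 6}(factor_cofactor ir) chinese_remainder ?coprime_cofactor //.
rewrite (eqP qm) (eqP qn) eqxx andbT.
set q := p i ^ a i in log_mn unit_mn *.
have cop : coprime (cofactor i) q by rewrite coprime_sym coprime_cofactor.
have a0 := a_ge1 ir.
have rem_mn : logn (p i) m`! %% a i = logn (p i) n`! %% a i.
  have aD : a i %| a i * totient q by apply: dvdn_mulr.
  by rewrite -(modn_dvdm (logn _ m`!) aD) log_mn modn_dvdm.
have exp_mn : cofactor i ^ bval m = cofactor i ^ bval n %[mod q].
  have val_mn : bval m = bval n %[mod totient q].
    apply/eqP; rewrite vm vn -(eqn_pmul2l a0) !muln_modr //.
    rewrite ![a i * (_ %/ _)]mulnC.
    rewrite -(eqn_modDr (logn (p i) m`! %% a i)) -divn_eq rem_mn -divn_eq.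
    exact/eqP.
  have red x : cofactor i ^ x = cofactor i ^ (x %% totient q) %[mod q].
    rewrite {1}(divn_eq x (totient q)) mulnC expnD expnM -modnMml -modnXm.
    by rewrite Euler_exp_totient // modnXm exp1n modnMml mul1n.
  by rewrite red val_mn -red.
have cop' : coprime q (cofactor i ^ bval n) by rewrite coprimeXr // coprime_sym.
have : cofactor i ^ bval n * quot m = cofactor i ^ bval n * quot n %[mod q].
  by rewrite -modnMml -exp_mn modnMml !quot_fact_unit // rem_mn -modnMmr unit_mn modnMmr.
by move/(modn_cancel cop')/eqP.
Qed.

Theorem last_digit_automatic i : 1 <= i <= r ->
  (forall j, 1 <= j <= r -> j <> i -> c j < c i) ->
  automatic (p i) (fun n => last_nonzero_digit b n`!).
Proof.
move=> ir dom; have pp := p_prime ir; have p1 := prime_gt1 pp; have a0 := a_ge1 ir.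
have [N NP] := last_digit_dominant ir dom.
set P := p i in pp p1 NP *; set q := P ^ a i.
have q0 : 0 < q by rewrite expn_gt0 prime_gt0.
(* A common multiple of the period of [coprime_fact] modulo [q] and of the modulus needed for the
   valuation. The residue of [n] is tracked too, since the valuation of [(n * P + d)!] is [n] plus
   that of [n!]. *)
set D := a i * (totient q * q).
have D0 : 0 < D by rewrite !muln_gt0 a0 totient_gt0 q0.
pose f n : 'I_D * 'I_D * 'I_q * 'I_N.+1 :=
  (Ordinal (ltn_pmod n D0), Ordinal (ltn_pmod (logn P n`!) D0),
   Ordinal (ltn_pmod (fact_unit P n) q0), Ordinal (geq_minr n N : minn n N < N.+1)).
apply: (@automatic_congruence _ _ _ _ f) => // [m n d dP|m n]; last first.
  move=> [_ log_mn unit_mn min_mn].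
  case: (ltnP m N) => mN; first by have -> : m = n by lia.
  have nN : N <= n by lia.
  have [[vm qm] [vn qn]] := (NP m mN, NP n nN).
  apply: (last_digit_congr ir) => //.
  have DD : a i * totient q %| D by rewrite /D mulnA dvdn_mulr.
  by rewrite -(modn_dvdm (logn _ m`!) DD) log_mn modn_dvdm.
move=> [mn log_mn unit_mn min_mn].
have divE x : (x * P + d) %/ P = x by rewrite divnMDl ?divn_small ?addn0 //; lia.
have mnD : m * P + d = n * P + d %[mod D].
  by rewrite -modnDml -modnMml mn modnMml modnDml.
rewrite /f; do 3?[congr (_, _)]; apply: val_inj => //=.
- rewrite !(logn_fact_divn (_ * P + d)) // !divE -modnDm mn log_mn modnDm //.
- rewrite !(fact_unit_divn (_ * P + d)) // !divE -modnMm unit_mn.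
  suff -> : coprime_fact P (m * P + d) = coprime_fact P (n * P + d) %[mod q].
    by rewrite modnMm.
  rewrite /q -(prednK a0); apply: coprime_fact_congr => //; rewrite prednK // -/q.
  have qD : totient q * q %| D by apply: dvdn_mull.
  by rewrite -(modn_dvdm (m * P + d) qD) mnD modn_dvdm.
- by apply: minn_congr => //; lia.
Qed.

Theorem last_digit_not_automatic i j k : 1 < k -> 1 <= i <= r -> 1 <= j <= r ->
  c i = c j -> p j < p i ->
  (forall l, 1 <= l <= r -> c l <= c i) ->
  (forall l, 1 <= l <= r -> c l = c i -> p l <= p i) ->
  ~ automatic k (fun n => last_nonzero_digit b n`!).
Proof.
move=> k1 ir jr cij pji c_max p_max; have pi := prime_gt1 (p_prime ir).
apply: (@not_automatic_gaps _ _ _ (fun x => ~~ (p i ^ a i %| x))) => // [n0 n00|t].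
  pose H := 2 * (p i * n0 + 1).
  have [K0 K0P] : exists K0, forall K, K0 <= K -> forall l, 1 <= l <= r ->
      c l = c i -> l <> i -> forall n, n < H * p i ^ K ->
      digit_sum (p l) n <= (p i - 1) * K.
    apply: eventually_forall => l lr.
    case: (ltnP (p l) (p i)) => [lt_p|le_p].
      have pl := prime_gt1 (p_prime lr).
      have [K0 K0P] := digit_sum_smaller_base H pl lt_p.
      by exists K0 => K KK _ _ n; apply: K0P.
    exists 0 => K _ cl li; case: li; apply: p_distinct => //.
    by apply/eqP; rewrite eqn_leq le_p p_max.
  have [N NP] : exists N, forall n, N <= n -> forall l, 1 <= l <= r ->
      c i * digit_sum (p l) n <= n.
    apply: eventually_forall => l lr.
    by apply: digit_sum_small; apply: prime_gt1; apply: p_prime.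
  have [t0 t0P] := @pred_multiple_in_block (p i) k n0 K0 pi k1.
  exists (maxn t0 N) => t; rewrite geq_max => /andP[tt0 tN].
  have [l [K [lt KK Kdvd nH]]] := t0P t tt0; exists l => //.
  set n := n0 * k ^ t + l in Kdvd nH *.
  have nN : N <= n.
    have : t < k ^ t by apply: ltn_expl.
    by rewrite /n; nia.
  apply: last_digit_hit => // [l' lr cl|l' lr cl]; last first.
    by split; [have := c_max l' lr; lia|apply: NP].
  case: (l' =P i) => [->//|li]; apply: leq_trans (K0P K KK l' lr cl li n nH) _.
  exact: digit_sum_pred_multiple.
have cop : coprime (p j) (p i).
  by apply: coprime_primes => //; apply: contraTneq pji => ->; rewrite ltnn.
have [n n0 nP] := digit_sum_gap (c i) t pi (p_prime jr) cop (ltnW k1).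
exists n => // l lt; rewrite (last_digit_gap ir jr) //.
exact: nP.
Qed.

End Factorization.

Theorem theorem3p7 (b r : nat) (p a : nat -> nat)
  (b_ge2 : 2 <= b)
  (p_prime : forall i, 1 <= i <= r -> prime (p i))
  (p_distinct : forall i j, 1 <= i <= r -> 1 <= j <= r -> p i = p j -> i = j)
  (a_ge1 : forall i, 1 <= i <= r -> 1 <= a i)
  (b_fact : b = \prod_(1 <= i < r.+1) p i ^ a i)
  (p_sorted : forall i j, 1 <= i -> i <= j -> j <= r ->
     a j * (p j - 1) <= a i * (p i - 1)) :
  ((r = 1 \/ (2 <= r /\ a 2 * (p 2 - 1) < a 1 * (p 1 - 1))) ->
     automatic (p 1) (fun n => last_nonzero_digit b n`!))
  /\
  ((2 <= r /\ a 1 * (p 1 - 1) = a 2 * (p 2 - 1)) ->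
     forall k, 2 <= k -> ~ automatic k (fun n => last_nonzero_digit b n`!)).
Proof.
split=> [r_dom|[r2 c12] k k2].
  apply: (@last_digit_automatic b r p a) => // [|j jr j1]; first by lia.
  have r2 : 2 <= r by lia.
  case: r_dom => [|[_]]; first by lia.
  by apply: leq_ltn_trans; apply: p_sorted; lia.
pose c i := a i * (p i - 1).
have r1 : 1 < r.+1 by lia.
(* Index 0 of the ordinal type is no prime index, hence the guard [1 <= l]. *)
pose tied (l : 'I_r.+1) := (1 <= l) && (c l == c 1).
case: (@arg_maxnP 'I_r.+1 (Ordinal r1) tied (fun l => p l)).
  by rewrite /tied /= eqxx.
move=> [i lt_ir] /andP[/= i1 /eqP ci] i_max.
have ir : 1 <= i <= r by rewrite i1.
have p_max l : 1 <= l <= r -> c l = c i -> p l <= p i.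
  move=> /andP[l1 lr] cl; apply: (i_max (Ordinal (lr : l < r.+1))).
  by rewrite /tied /= l1 cl ci eqxx.
(* Indices 1 and 2 are both tied, so one of them differs from [i]. *)
have [j [jr ji cj]] : exists j, [/\ 1 <= j <= r, j <> i & c i = c j].
  case: (i =P 1) => [i_1|i_1]; last by exists 1; split=> //; lia.
  by exists 2; split; [lia|rewrite i_1|rewrite i_1 /c].
apply: (@last_digit_not_automatic b r p a _ _ _ _ i j) => //.
  rewrite ltn_neqAle p_max // andbT; apply/eqP => pij; apply: ji.
  by apply: p_distinct.
by move=> l /andP[l1 lr]; rewrite -/(c i) ci; apply: p_sorted.
Qed.
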